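(* Let $\mathcal{T}$ be a $\Sigma$-theory and $S$ a finite set of sorts of $\Sigma$. Then the following are equivalent: (1) $\mathcal{T}$ is stably finite and finitely smooth with respect to $S$; (2) $\mathcal{T}$ is stably infinite and has a strong pre-witness with respect to $S$.
   Context: Many-sorted first-order logic with equality; $\Sigma$ is a signature of arbitrary cardinality. A $\Sigma$-theory $\mathcal{T}$ is the class of $\Sigma$-interpretations (structures with non-empty domains $\sigma^{\mathcal{A}}$ per sort plus variable assignments) satisfying a set of sentences; members are $\mathcal{T}$-interpretations; formulas are $\mathcal{T}$-equivalent if satisfied by the same $\mathcal{T}$-interpretations. $\mathrm{QF}(\Sigma)$: quantifier-free formulas; $\mathrm{vars}_\sigma(\varphi)$: free variables of sort $\sigma$. Stably infinite w.r.t. $S$: every $\mathcal{T}$-satisfiable quantifier-free formula has a $\mathcal{T}$-model $\mathcal{A}$ with $\sigma^{\mathcal{A}}$ infinite for all $\sigma\in S$. Stably finite w.r.t. $S$: for every quantifier-free $\varphi$ and $\mathcal{T}$-interpretation $\mathcal{A}\models\varphi$ there is a $\mathcal{T}$-interpretation $\mathcal{B}\models\varphi$ with $\sigma^{\mathcal{B}}$ finite and $|\sigma^{\mathcal{B}}|\le|\sigma^{\mathcal{A}}|$ for $\sigma\in S$. Finitely smooth w.r.t. $S$: for every quantifier-free $\varphi$, $\mathcal{T}$-interpretation $\mathcal{A}\models\varphi$ and function $\kappa$ from $S$ to natural numbers with $\kappa(\sigma)\ge|\sigma^{\mathcal{A}}|$, there is a $\mathcal{T}$-interpretation $\mathcal{B}\models\varphi$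 with $|\sigma^{\mathcal{B}}|=\kappa(\sigma)$ for $\sigma\in S$. For a finite set $V$ of variables and an equivalence relation $E$ on $V$ relating only same-sort variables, the arrangement $\delta_V^E$ is the conjunction of $x=y$ for $xEy$ and $\neg(x=y)$ otherwise. A strong pre-witness w.r.t. $S$ is a (not necessarily computable) function $\mathit{wit}:\mathrm{QF}(\Sigma)\to\mathrm{QF}(\Sigma)$ such that for every $\varphi$: $\varphi$ and $\exists\vec{x}\,\mathit{wit}(\varphi)$ are $\mathcal{T}$-equivalent where $\vec{x}=\mathrm{vars}(\mathit{wit}(\varphi))\setminus\mathrm{vars}(\varphi)$; and for every finite set $V$ of variables with sorts in $S$ and arrangement $\delta_V$ on $V$ (including the empty arrangement), if $\mathit{wit}(\varphi)\wedge\delta_V$ is $\mathcal{T}$-satisfiable then some $\mathcal{T}$-interpretation $\mathcal{A}$ satisfies it with $\sigma^{\mathcal{A}}=\mathrm{vars}_\sigma(\mathit{wit}(\varphi)\wedge\delta_V)^{\mathcal{A}}$ for all $\sigma\in S$. *)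

(* Defs.v *)
From HB Require Import structures.
From mathcomp Require Import all_boot finmap.
From mathcomp Require Import boolp classical_sets functions cardinality.

Set Implicit Arguments.
Unset Strict Implicit.
Unset Printing Implicit Defensive.

Local Open Scope fset_scope.
Local Open Scope classical_set_scope.
Local Open Scope card_scope.

(* The sorts form a choiceType only so that finite sets of sorts and of
   variables can be written {fset _}; classically every type carries such a
   structure, so the sets of sorts and of symbols are arbitrary. *)
Record signature := Signature {
  sorts : choiceType;
  fsym : Type;
  psym : Type;
  farity : fsym -> nat;
  fdom : forall f : fsym, 'I_(farity f) -> sorts;
  fcod : fsym -> sorts;
  parity : psym -> nat;
  pdom : forall p : psym, 'I_(parity p) -> sorts }.

(* Countably many variables of each sort: (s, n) is the n-th variable of
   sort s. *)
Definition var (Sg : signature) : choiceType := (sorts Sg * nat)%type.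

Definition vsort (Sg : signature) (x : var Sg) : sorts Sg := x.1.

Inductive term (Sg : signature) : sorts Sg -> Type :=
| tVar (x : var Sg) : term (vsort x)
| tApp (f : fsym Sg) (t : forall i, term (fdom (f := f) i)) : term (fcod f).

Inductive formula (Sg : signature) : Type :=
| fTop
| fEq (s : sorts Sg) (t u : term s)
| fPred (p : psym Sg) (t : forall i, term (pdom (p := p) i))
| fNot (phi : formula Sg)
| fAnd (phi psi : formula Sg)
| fOr (phi psi : formula Sg)
| fImp (phi psi : formula Sg)
| fAll (x : var Sg) (phi : formula Sg)
| fEx (x : var Sg) (phi : formula Sg).

Arguments fTop {Sg}.

Fixpoint tvars (Sg : signature) (s : sorts Sg) (t : term s) : {fset var Sg} :=
  match t with
  | tVar x => [fset x]
  | tApp f t => \bigcup_(i in 'I_(farity f)) tvars (t i)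
  end%fset.

Fixpoint vars (Sg : signature) (phi : formula Sg) : {fset var Sg} :=
  match phi with
  | fTop => fset0
  | fEq s t u => tvars t `|` tvars u
  | fPred p t => \bigcup_(i in 'I_(parity p)) tvars (t i)
  | fNot phi => vars phi
  | fAnd phi psi | fOr phi psi | fImp phi psi => vars phi `|` vars psi
  | fAll x phi | fEx x phi => vars phi `\ x
  end%fset.

Fixpoint quantifier_free (Sg : signature) (phi : formula Sg) : bool :=
  match phi with
  | fTop | fEq _ _ _ | fPred _ _ => true
  | fNot phi => quantifier_free phi
  | fAnd phi psi | fOr phi psi | fImp phi psi =>
      quantifier_free phi && quantifier_free psi
  | fAll _ _ | fEx _ _ => false
  end.

Definition QF (Sg : signature) := {phi : formula Sg | quantifier_free phi}.

Record structure (Sg : signature) := Structure {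
  dom :> sorts Sg -> Type;
  dom_inhabited : forall s, inhabited (dom s);
  finterp : forall f : fsym Sg, (forall i, dom (fdom (f := f) i)) -> dom (fcod f);
  pinterp : forall p : psym Sg, (forall i, dom (pdom (p := p) i)) -> Prop }.

Definition assignment (Sg : signature) (M : structure Sg) :=
  forall x : var Sg, M (vsort x).

Fixpoint teval (Sg : signature) (M : structure Sg) (a : assignment M)
    (s : sorts Sg) (t : term s) : M s :=
  match t with
  | tVar x => a x
  | tApp f t => finterp (fun i => teval a (t i))
  end.

Definition agree_off (Sg : signature) (M : structure Sg) (x : var Sg)
  (a b : assignment M) := forall y, y != x -> a y = b y.

(* The values that may be given to x range over the assignments differing from
   a at most at x. *)
Fixpoint holds (Sg : signature) (M : structure Sg) (a : assignment M)
    (phi : formula Sg) : Prop :=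
  match phi with
  | fTop => True
  | fEq s t u => teval a t = teval a u
  | fPred p t => pinterp (fun i => teval a (t i))
  | fNot phi => ~ holds a phi
  | fAnd phi psi => holds a phi /\ holds a psi
  | fOr phi psi => holds a phi \/ holds a psi
  | fImp phi psi => holds a phi -> holds a psi
  | fAll x phi => forall b, agree_off x a b -> holds b phi
  | fEx x phi => exists2 b, agree_off x a b & holds b phi
  end.

Record interpretation (Sg : signature) := Interpretation {
  struct :> structure Sg;
  assign : assignment struct }.

Definition satisfies (Sg : signature) (A : interpretation Sg)
  (phi : formula Sg) := holds (assign A) phi.

Record theory (Sg : signature) := Theory {
  axioms : set (formula Sg);
  axioms_closed : forall phi, axioms phi -> vars phi = fset0 }.

Definition models (Sg : signature) (T : theory Sg) (A : interpretation Sg) :=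
  forall phi, axioms T phi -> satisfies A phi.

Definition satisfiable (Sg : signature) (T : theory Sg) (phi : formula Sg) :=
  exists2 A, models T A & satisfies A phi.

Definition equivalent (Sg : signature) (T : theory Sg)
  (phi psi : formula Sg) :=
  forall A, models T A -> (satisfies A phi <-> satisfies A psi).

Definition stably_infinite (Sg : signature) (T : theory Sg)
    (S : {fset sorts Sg}) :=
  forall phi : QF Sg, satisfiable T (val phi) ->
  exists A, [/\ models T A, satisfies A (val phi) &
    forall s, s \in S -> infinite_set [set: A s]].

Definition stably_finite (Sg : signature) (T : theory Sg)
    (S : {fset sorts Sg}) :=
  forall (phi : QF Sg) (A : interpretation Sg),
    models T A -> satisfies A (val phi) ->
  exists B, [/\ models T B, satisfies B (val phi) &
    forall s, s \in S -> finite_set [set: B s] /\ [set: B s] #<= [set: A s]].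

Definition finitely_smooth (Sg : signature) (T : theory Sg)
    (S : {fset sorts Sg}) :=
  forall (phi : QF Sg) (A : interpretation Sg) (kappa : S -> nat),
    models T A -> satisfies A (val phi) ->
    (forall s : S, [set: A (val s)] #<= `I_(kappa s)) ->
  exists B, [/\ models T B, satisfies B (val phi) &
    forall s : S, [set: B (val s)] #= `I_(kappa s)].

(* When x and y have the same sort, y = (vsort x, y.2) and this is x = y;
   it is only used in that case. *)
Definition eq_var (Sg : signature) (x y : var Sg) : formula Sg :=
  fEq (tVar x) (tVar ((vsort x, y.2) : var Sg)).

Definition same_sort_equivalence (Sg : signature) (V : {fset var Sg})
    (E : rel V) :=
  equivalence_rel E /\ forall x y : V, E x y -> vsort (val x) = vsort (val y).

(* The empty arrangement is fTop. *)
Definition arrangement (Sg : signature) (V : {fset var Sg}) (E : rel V) :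
    formula Sg :=
  \big[@fAnd Sg/fTop]_(p : V * V | vsort (val p.1) == vsort (val p.2))
    let e := eq_var (val p.1) (val p.2) in
    if E p.1 p.2 then e else fNot e.

Definition exists_closure (Sg : signature) (X : {fset var Sg})
  (phi : formula Sg) : formula Sg := foldr (@fEx Sg) phi X.

(* s^A = vars_s(phi)^A *)
Definition named_by_vars (Sg : signature) (A : interpretation Sg)
    (phi : formula Sg) (s : sorts Sg) :=
  [set: A s] =
  (fun n : nat => assign A ((s, n) : var Sg) : A s) @` [set n | (s, n) \in vars phi].

Definition strong_prewitness (Sg : signature) (T : theory Sg)
    (S : {fset sorts Sg}) (wit : QF Sg -> QF Sg) :=
  forall phi : QF Sg,
    equivalent T (val phi)
      (exists_closure (vars (val (wit phi)) `\` vars (val phi))%fset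
         (val (wit phi))) /\
    forall (V : {fset var Sg}) (E : rel V),
      (forall x, x \in V -> vsort x \in S) -> same_sort_equivalence E ->
      let psi := fAnd (val (wit phi)) (arrangement E) in
      satisfiable T psi ->
      exists A, [/\ models T A, satisfies A psi &
        forall s, s \in S -> named_by_vars A psi s].

Definition has_strong_prewitness (Sg : signature) (T : theory Sg)
  (S : {fset sorts Sg}) := exists wit, strong_prewitness T S wit.

(* Main.v *)
(* From (1) to (2). By (1) a satisfiable phi has models whose S-domains are
   arbitrarily large, and their ultraproduct over a free ultrafilter on nat is
   infinite on S. For the pre-witness, Dickson's lemma gives a bound N such
   that every model of phi can be replaced by a smaller one, with the same
   arrangement of the S-variables of phi, of size at most N on S. With N fresh
   variables for each sort in S, wit(phi) says that the arrangement of the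
   S-variables of phi and of the fresh variables is one that is realized in a
   model of phi whose S-domains these variables exhaust. A model of wit(phi) and
   of an arrangement on further variables then yields, by finite smoothness, a
   model of phi whose S-domains have as many elements as these variables name,
   and the further variables can be reassigned there to exhaust the domains.
   From (2) to (1). The arrangement of the S-variables of wit(phi) in a model A
   gives a model in which only as many elements exist as are named in A. To reach
   prescribed larger sizes, first pass to a model with infinite S-domains and
   give new values there to fresh variables. *)
Require Import Defs.
From mathcomp Require Import all_boot finmap.
From mathcomp Require Import boolp classical_sets functions cardinality filter.

Set Implicit Arguments.
Unset Strict Implicit.
Unset Printing Implicit Defensive.

Local Open Scope fset_scope.
Local Open Scope classical_set_scope.
Local Open Scope card_scope.

(** * Satisfaction, free variables and finite conjunctions *)

Section Semantics.
Variable Sg : signature.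
Implicit Types (M : structure Sg) (phi psi : formula Sg) (X : {fset var Sg}).

Lemma teval_eq_on M (a b : assignment M) s (t : term s) :
  (forall x, x \in tvars t -> a x = b x) -> teval a t = teval b t.
Proof.
elim: t => [x|f t IH] /= ab; first by apply: ab; rewrite inE.
congr finterp; apply: functional_extensionality_dep => i; apply: IH => x xt.
by apply: ab; apply/bigfcupP; exists i; rewrite ?mem_index_enum.
Qed.

(** Quantifier step of [holds_eq_on]: [b'] takes the value of [a'] at [x] and is [b] elsewhere. *)
Lemma agree_off_eq_on M (a b a' : assignment M) x phi :
  (forall y, y \in (vars phi `\ x)%fset -> a y = b y) -> agree_off x a a' ->
  exists2 b', agree_off x b b' & forall y, y \in vars phi -> a' y = b' y.
Proof.
move=> ab aa'; exists (fun y => if y == x then a' y else b y).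
  by move=> y /negbTE ->.
move=> y yphi; case: (eqVneq y x) => [//|yx].
by rewrite -aa' // ab // !inE yx.
Qed.

Lemma holds_eq_on M phi (a b : assignment M) :
  (forall x, x \in vars phi -> a x = b x) -> holds a phi <-> holds b phi.
Proof.
elim: phi a b => [|s t u|p t|phi IH|phi IH psi IH'|phi IH psi IH'
  |phi IH psi IH'|x phi IH|x phi IH] a b /= ab //.
- by rewrite !(@teval_eq_on _ a b) // => x xt; apply: ab; rewrite inE xt ?orbT.
- suff -> : (fun i => teval a (t i)) = (fun i => teval b (t i)) by [].
  apply: functional_extensionality_dep => i; apply: teval_eq_on => x xt.
  by apply: ab; apply/bigfcupP; exists i; rewrite ?mem_index_enum.
- by rewrite (IH a b).
- by rewrite (IH a b) ?(IH' a b) // => x xp; apply: ab; rewrite inE xp ?orbT.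
- by rewrite (IH a b) ?(IH' a b) // => x xp; apply: ab; rewrite inE xp ?orbT.
- by rewrite (IH a b) ?(IH' a b) // => x xp; apply: ab; rewrite inE xp ?orbT.
- have ba y : y \in (vars phi `\ x)%fset -> b y = a y by move=> /ab.
  split=> H c /[dup] hc.
    by case/(agree_off_eq_on ba) => c' /H hc' /IH e; apply/e.
  by case/(agree_off_eq_on ab) => c' /H hc' /IH e; apply/e.
- have ba y : y \in (vars phi `\ x)%fset -> b y = a y by move=> /ab.
  split=> -[c].
    by case/(agree_off_eq_on ab) => c' hc' /IH e /e; exists c'.
  by case/(agree_off_eq_on ba) => c' hc' /IH e /e; exists c'.
Qed.

(** Axioms are sentences, so variables can be given new values without leaving the theory. *)
Lemma models_reassign (T : theory Sg) M (a b : assignment M) :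
  models T (Interpretation a) -> models T (Interpretation b).
Proof.
move=> Ta phi Tphi; apply/(@holds_eq_on _ _ a); last exact: Ta.
by move=> x; rewrite (axioms_closed Tphi) inE.
Qed.

Lemma holds_exists_closure M (X : {fset var Sg}) phi (a : assignment M) :
  holds a (exists_closure X phi) <->
  exists2 b, (forall x, x \notin X -> a x = b x) & holds b phi.
Proof.
rewrite /exists_closure; transitivity (exists2 b,
  forall x, x \notin enum_fset X -> a x = b x & holds b phi); last by [].
elim: (enum_fset X) a => [|x s IH] a /=.
  split=> [h|[b ab]]; first by exists a.
  by apply: iffRL; apply: holds_eq_on => x _; apply: ab.
split=> [[b ab /IH[c bc hc]]|[c ac hc]].
  exists c => // y; rewrite inE negb_or => /andP[yx ys].
  by rewrite ab // bc.
exists (fun y => if y == x then c y else a y); first by move=> y /negbTE ->.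
apply/IH; exists c => // y ys; case: (eqVneq y x) => // yx.
by apply: ac; rewrite inE negb_or yx.
Qed.

Lemma holds_bigAnd (I : finType) (P : pred I) (F : I -> formula Sg) M
    (a : assignment M) :
  holds a (\big[@fAnd Sg/fTop]_(i | P i) F i) <->
  forall i, P i -> holds a (F i).
Proof.
rewrite -big_filter /=.
have -> : (forall i, P i -> holds a (F i)) <->
    (forall i, i \in [seq i <- index_enum I | P i] -> holds a (F i)).
  split=> h i.
    by rewrite mem_filter => /andP[/h].
  by move=> Pi; apply: h; rewrite mem_filter Pi mem_index_enum.
elim: [seq _ <- _ | _] => [|i r IH]; first by rewrite big_nil.
rewrite big_cons /= IH; split=> [[hi hr] j|h].
  by rewrite inE => /orP[/eqP->|/hr].
split=> [|j jr]; apply: h; first by rewrite inE eqxx.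
by rewrite inE jr orbT.
Qed.

Lemma vars_bigAnd (I : finType) (P : pred I) (F : I -> formula Sg) :
  vars (\big[@fAnd Sg/fTop]_(i | P i) F i) = (\bigcup_(i | P i) vars (F i))%fset.
Proof. exact: (big_morph (@vars Sg)). Qed.

Lemma quantifier_free_bigAnd (I : finType) (P : pred I) (F : I -> formula Sg) :
  (forall i, P i -> quantifier_free (F i)) ->
  quantifier_free (\big[@fAnd Sg/fTop]_(i | P i) F i).
Proof.
by move=> h; apply: (big_ind (fun psi => quantifier_free psi)) => //= ? ? -> ->.
Qed.

End Semantics.

Lemma dependent_choice_fun (I : Type) (T : I -> Type) (P : forall i, T i -> Prop) :
  (forall i, exists x, P i x) -> exists f, forall i, P i (f i).
Proof. by move=> /(_ _)/cid-/all_sig[f Pf]; exists f. Qed.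

(** * Ultraproducts and the theorem of Los *)

Section Ultraproduct.
Variables (Sg : signature) (I : Type) (F : set_system I).
Hypothesis FU : UltraFilter F.
Variable M : I -> structure Sg.

(** Taking whole equivalence classes as elements turns equality modulo [F] into plain equality, as
    the semantics of [fEq] requires. *)
Definition ultradom (s : sorts Sg) : Type :=
  {X : set (forall i, M i s) | exists f, X = [set g | F [set i | g i = f i]]}.

Definition uclass s (f : forall i, M i s) : ultradom s :=
  exist _ [set g | F [set i | g i = f i]] (ex_intro _ f erefl).

Definition urepr s (d : ultradom s) : forall i, M i s := projT1 (cid (svalP d)).

Lemma uclass_eq s (f g : forall i, M i s) :
  uclass f = uclass g <-> F [set i | f i = g i].
Proof.
split=> [/(congr1 sval)/= e|fg].
  have : [set h | F [set i | h i = g i]] f by rewrite -e /=; apply: filterE.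
  by [].
rewrite /uclass; apply: eq_exist; apply/seteqP; split=> h /=.
  by apply: filter_app; move: fg; apply: filterS => i /= ->.
by apply: filter_app; move: fg; apply: filterS => i /= ->.
Qed.

Lemma ureprK s (d : ultradom s) : uclass (urepr d) = d.
Proof.
rewrite /urepr; case: (cid _) => f e /=.
by case: d e => X X_class /= e; rewrite /uclass; apply: eq_exist.
Qed.

Lemma urepr_class s (f : forall i, M i s) : F [set i | urepr (uclass f) i = f i].
Proof. by apply/uclass_eq; rewrite ureprK. Qed.

Lemma ultradom_inhabited s : inhabited (ultradom s).
Proof.
have /dependent_choice_fun[f _] : forall i, exists x : M i s, True.
  by move=> i; case: (dom_inhabited (M i) s) => x; exists x.
exact: inhabits (uclass f).
Qed.

Definition ultraproduct : structure Sg := @Structure Sg ultradom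
  ultradom_inhabited
  (fun f t => uclass (fun i => finterp (fun j => urepr (t j) i)))
  (fun p t => F [set i | pinterp (fun j => urepr (t j) i)]).

Definition uassign (a : forall i, assignment (M i)) : assignment ultraproduct :=
  fun x => uclass (fun i => a i x).

Lemma teval_ultraproduct (a : forall i, assignment (M i)) s (t : term s) :
  teval (uassign a) t = uclass (fun i => teval (a i) t).
Proof.
elim: t => [//|f t IH] /=; apply/uclass_eq.
(* The arguments of [f] are finitely many, so a single set in [F] serves for all of them. *)
have : F [set i | forall j, urepr (teval (uassign a) (t j)) i = teval (a i) (t j)].
  by apply: filter_forall => j; rewrite IH; exact: urepr_class.
apply: filterS => i /= e; congr finterp.
exact: functional_extensionality_dep.
Qed.

Lemma ultra_not (A : set I) : F (~` A) <-> ~ F A.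
Proof.
split=> [FnA FA|]; last by case: (in_ultra_setVsetC A FU).
by case: (filter_ex (filterI FA FnA)) => i [].
Qed.

(** The quantifier case of [Los], with witnesses chosen coordinatewise. [Q] and [P] are arbitrary so
    that universal quantifiers can be treated through the negated formula. *)
Lemma ultraproduct_exists x (a : forall i, assignment (M i))
    (Q : assignment ultraproduct -> Prop) (P : forall i, assignment (M i) -> Prop) :
  (forall a, Q (uassign a) <-> F [set i | P i (a i)]) ->
  (exists2 b, agree_off x (uassign a) b & Q b) <->
  F [set i | exists2 b, agree_off x (a i) b & P i b].
Proof.
move=> QP; split=> [[b ab Qb]|].
  pose b' i : assignment (M i) := fun y => if y == x then urepr (b y) i else a i y.
  have bb' : b = uassign b'.
    apply: functional_extensionality_dep => y; rewrite /uassign /b'.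
    by case: (eqVneq y x) => [|yx]; [rewrite ureprK|rewrite -ab].
  move: Qb; rewrite bb' => /QP; apply: filterS => i /= Pb.
  by exists (b' i) => // y yx; rewrite /b' (negbTE yx).
move=> Fex.
(* Where no witness exists, [a i] itself serves; such [i] lie outside a set in [F]. *)
have /dependent_choice_fun[b hb] : forall i, exists b, agree_off x (a i) b /\
    ((exists2 b, agree_off x (a i) b & P i b) -> P i b).
  move=> i.
  case: (pselect (exists2 b, agree_off x (a i) b & P i b)) => [[b ab Pb]|nex].
    by exists b.
  by exists (a i); split.
exists (uassign b); last by apply/QP; apply: filterS Fex => i; exact: (hb i).2.
move=> y yx; congr uclass; apply: functional_extensionality_dep => i.
exact: (hb i).1.
Qed.

Lemma Los phi (a : forall i, assignment (M i)) :
  holds (uassign a) phi <-> F [set i | holds (a i) phi].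
Proof.
elim: phi a => [|s t u|p t|phi IH|phi IH psi IH'|phi IH psi IH'
  |phi IH psi IH'|x phi IH|x phi IH] a /=.
- by split=> // _; apply: filterE.
- by rewrite !teval_ultraproduct; exact: uclass_eq.
- have e : F [set i | (fun j => urepr (teval (uassign a) (t j)) i) =
      (fun j => teval (a i) (t j))].
    have : F [set i | forall j,
        urepr (teval (uassign a) (t j)) i = teval (a i) (t j)].
      by apply: filter_forall => j; rewrite teval_ultraproduct; exact: urepr_class.
    by apply: filterS => i /= h; apply: functional_extensionality_dep.
  by split; apply: filter_app; apply: filterS e => i /= ->.
- by rewrite IH -ultra_not.
- rewrite IH IH'; split=> [[]|h]; first exact: filterI.
  by split; apply: filterS h => i [].
- rewrite IH IH'; split=> [[] h|h].
  - by apply: filterS h => i; left.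
  - by apply: filterS h => i; right.
   apply: contrapT => /not_orP[/ultra_not n1 /ultra_not n2].
  by case: (filter_ex (filterI h (filterI n1 n2))) => i /= [[]] ? [].
- rewrite IH IH'; split=> [h|h h']; last first.
    by apply: filterS (filterI h h') => i /= [].
  case: (in_ultra_setVsetC [set i | holds (a i) phi] FU) => [/h|] h'.
    by apply: filterS h' => i /=.
  by apply: filterS h' => i /= nphi /nphi.
(* A universal formula is handled as the negation of an existential one. *)
- have e := @ultraproduct_exists x a (fun b => ~ holds b phi)
    (fun i b => ~ holds b phi).
  have {}/e/not_iff_compat : forall c, ~ holds (uassign c) phi <->
      F [set i | ~ holds (c i) phi].
    by move=> c; rewrite IH -ultra_not.
  rewrite -ultra_not => e.
  transitivity (~ exists2 b, agree_off x (uassign a) b & ~ holds b phi).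
    split=> [h [b /h]//|h b ab]; apply: contrapT => nb; apply: h.
    by exists b.
  rewrite e; split; apply: filterS => i /= h.
    by move=> b ab; apply: contrapT => nb; apply: h; exists b.
  by case=> b /h.
- exact: ultraproduct_exists.
Qed.

End Ultraproduct.

(** * Injections and models with infinite domains *)

Lemma card_le_injP (T U : Type) (A : set T) (B : set U) : inhabited U ->
  A #<= B <-> exists f : T -> U, (forall x, A x -> B (f x)) /\
    forall x y, A x -> A y -> f x = f y -> x = y.
Proof.
move=> [u0]; split=> [/card_leP[f]|[f [AB finj]]].
  have /choice[g hg] : forall x, exists y,
      forall Ax : x \in A, y = val (f (exist _ x Ax)).
    move=> x; case: (pselect (x \in A)) => [Ax|nAx]; last by exists u0.
    exists (val (f (exist _ x Ax))) => Ax'.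
    by rewrite (bool_irrelevance Ax Ax').
  exists g; split=> [x /mem_set Ax|x y /mem_set Ax /mem_set Ay].
    by rewrite (hg _ Ax); apply: set_mem; exact: valP.
  rewrite (hg _ Ax) (hg _ Ay) => /val_inj /inj e.
  by have /(congr1 val) := e (mem_set Logic.I) (mem_set Logic.I).
have finj' : {in A &, injective f}.
  by move=> x y; rewrite !inE; exact: finj.
rewrite -(card_le_eql (inj_card_eq finj')).
by apply: subset_card_le => _ [x /AB ? <-].
Qed.

Lemma stably_infinite_of_unbounded (Sg : signature) (T : theory Sg)
    (S : {fset sorts Sg}) (phi : formula Sg) :
  (forall n, exists A, [/\ models T A, satisfies A phi &
     forall s, s \in S -> `I_n #<= [set: A s]]) ->
  exists A, [/\ models T A, satisfies A phi &
    forall s, s \in S -> infinite_set [set: A s]].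
Proof.
move=> /choice[A hA].
have [F [FU ooF]] := ultraFilterLemma eventually_filter.
exists (Interpretation (uassign F (fun n => assign (A n)))); split.
- move=> psi Tpsi; apply/Los; apply: filterE => n.
  by have [TA _ _] := hA n; exact: TA.
- by apply/Los; apply: filterE => n; have [] := hA n.
move=> s sS; apply/infiniteP.
have /dependent_choice_fun[e he] : forall n, exists e : nat -> A n s,
    forall i j, i < n -> j < n -> e i = e j -> i = j.
  move=> n; have [_ _ /(_ s sS)] := hA n.
  by case/(card_le_injP _ _ (dom_inhabited _ _)) => f [_ finj]; exists f.
apply/(card_le_injP _ _ (ultradom_inhabited _ _ _)).
(* Any [i] and [j] lie below almost all [n], and there [e n] separates them. *)
exists (fun i => uclass F (fun n => e n i)); split=> // i j _ _ /uclass_eq eij.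
have /filter_ex[n [/= ni /he]] :
    F ([set n | maxn i j < n] `&` [set n | e n i = e n j]).
  by apply: filterI => //; apply: ooF; exists (maxn i j).+1.
by move: ni; rewrite gtn_max => /andP[ni nj]; exact.
Qed.

Lemma finite_card_le_sub_eq (T : Type) (A P : set T) :
  finite_set P -> A `<=` P -> P #<= A -> A = P.
Proof.
(* A choice structure on [T] turns the finite sets into elements of [{fset T}]. *)
elim/Pchoice: T => T in A P *.
move=> Pfin AP; have Afin := sub_finite_set AP Pfin.
case/finite_fsetP: Pfin AP => X -> {P}; case/finite_fsetP: Afin => Y -> {A} YX.
have eX : [set` X] #= `I_#|` X| by apply/card_eq_fsetP.
have eY : [set` Y] #= `I_#|` Y| by apply/card_eq_fsetP.
rewrite (card_le_eql eX) (card_le_eqr eY) card_le_II => XY.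
suff -> : Y = X by [].
by apply/eqP; rewrite eqEfcard XY andbT; apply/fsubsetP.
Qed.

(** Elements of [P] are treated one at a time. A free value always remains: otherwise the injection
    on the finite set [R] would already cover [U], so [P] would be no larger than [R], and
    [R = P]. *)
Lemma extend_injection (T U : Type) (P Q : set T) (g : T -> U) :
  finite_set P -> Q `<=` P -> P #<= [set: U] ->
  (forall x y, Q x -> Q y -> g x = g y -> x = y) ->
  exists f : T -> U, (forall x, Q x -> f x = g x) /\
    forall x y, P x -> P y -> f x = f y -> x = y.
Proof.
elim/Pchoice: T => T in P Q g *.
move=> Pfin QP PU ginj; case/finite_seqP: (Pfin) => s Ps.
suff [f [fg finj]] : exists f : T -> U, (forall x, Q x -> f x = g x) /\
    forall x y, (Q `|` [set` s]) x -> (Q `|` [set` s]) y -> f x = f y -> x = y.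
  by exists f; split=> // x y; rewrite Ps => xs ys; apply: finj; right.
have : [set` s] `<=` P by rewrite Ps.
elim: s {Ps} => [_|z s IH zsP].
  by exists g; split=> // x y [Qx|//] [Qy|//]; exact: ginj.
have sP : [set` s] `<=` P by move=> x xs; apply: zsP; rewrite /= inE xs orbT.
have [f [fg finj]] := IH sP.
set R := Q `|` [set` s] in finj.
have RP : R `<=` P by move=> x [/QP//|/sP].
have sub x : (Q `|` [set` z :: s]) x -> x = z \/ R x.
  move=> [Qx|]; first by right; left.
  by rewrite /= inE => /orP[/eqP|xs]; [left|right; right].
case: (pselect (R z)) => [Rz|nRz].
  by exists f; split=> // x y /sub[->|Rx] /sub[->|Ry]; apply: finj.
have [u nu] : exists u, ~ (f @` R) u.
  apply: contrapT => nex; apply: nRz.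
  have -> : R = P; last by apply: zsP; rewrite /= mem_head.
  apply: finite_card_le_sub_eq => //; apply: card_le_trans PU _.
  have finj' : {in R &, injective f} by move=> x y; rewrite !inE; exact: finj.
  rewrite -(card_le_eqr (inj_card_eq finj')); apply: subset_card_le => u _.
  by apply: contrapT => nu; apply: nex; exists u.
exists (fun x => if x == z then u else f x); split=> [x Qx|x y].
  by case: eqP Qx => [-> Qz|_ /fg//]; case: nRz; left.
have fz t : R t -> (t == z) = false by move=> Rt; apply/eqP=> e; rewrite e in Rt.
move=> /sub[->|Rx] /sub[->|Ry]; rewrite ?eqxx ?fz //.
- by move=> uf; case: nu; exists y.
- by move=> uf; case: nu; exists x.
- exact: finj.
Qed.

(** * Dickson's lemma *)

(** Induction on the coordinates. Let [F0] be a finite basis of [U] for [l], and [m] its largest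
    [i]-th coordinate. Vectors with [u i >= m] lie above a member of [F0] also at [i]; the others
    fall into the finitely many slices [u i = j < m], each with a finite basis [G j]. *)
Lemma dickson (I : eqType) (l : seq I) (U : set (I -> nat)) :
  exists F : seq (I -> nat), (forall u, u \in F -> U u) /\
    forall u, U u -> exists2 v, v \in F & forall i, i \in l -> v i <= u i.
Proof.
elim: l U => [|i l IH] U.
  case: (pselect (exists u, U u)) => [[u Uu]|nU].
    exists [:: u]; split=> [v|v _]; first by rewrite inE => /eqP->.
    by exists u; rewrite ?mem_head.
  by exists [::]; split=> // u Uu; case: nU; exists u.
have [F0 [F0U hF0]] := IH U.
have /choice[G hG] := fun j => IH (U `&` [set u | u i = j]).
pose m := \max_(u <- F0) u i.
exists (F0 ++ flatten [seq G j | j <- iota 0 m]); split=> [u|u Uu].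
  rewrite mem_cat => /orP[/F0U//|/flattenP[s /mapP[j _ ->]]].
  by case: (hG j) => GU _ /GU[].
case: (leqP m (u i)) => [mu|um].
  have [v vF vu] := hF0 u Uu; exists v; first by rewrite mem_cat vF.
  move=> k; rewrite inE => /orP[/eqP->|/vu//].
  by apply: leq_trans mu; exact: leq_bigmax_seq.
have [GU /(_ u)[//|v vG vu]] := hG (u i).
exists v.
  rewrite mem_cat; apply/orP; right; apply/flattenP; exists (G (u i)) => //.
  by apply/mapP; exists (u i); rewrite ?mem_iota.
by move=> k; rewrite inE => /orP[/eqP->|/vu//]; have [_ /= ->] := GU v vG.
Qed.

(** The bound is the largest coordinate in [l] of a finite basis. *)
Lemma dickson_bounded (I : eqType) (l : seq I) (U : set (I -> nat)) :
  exists N, forall u, U u ->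
    exists2 v, U v & forall i, i \in l -> v i <= u i /\ v i <= N.
Proof.
have [F [FU hF]] := dickson l U.
exists (\max_(u <- F) \max_(i <- l) u i) => u /hF[v vF vu].
exists v => [|i il]; [exact: FU|split; first exact: vu].
apply: (@leq_trans (\max_(i <- l) v i)); first exact: leq_bigmax_seq.
exact: (leq_bigmax_seq (F := fun u : I -> nat => \max_(i <- l) u i)).
Qed.

(** * Arrangements and transfer of equalities between assignments *)

Section Arrangements.
Variable Sg : signature.
Implicit Types (V X : {fset var Sg}) (D : sorts Sg -> Type).

(* Assignments into an arbitrary family of domains: those into nat, which belong
   to no structure, are compared with those into models. *)
Definition named D (a : forall x : var Sg, D (vsort x)) V (s : sorts Sg) :
    set (D s) :=
  (fun n : nat => a ((s, n) : var Sg) : D s) @` [set n | (s, n) \in V].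
Arguments named {D} a V s.

Definition same_equalities D D' (a : forall x : var Sg, D (vsort x))
    (b : forall x : var Sg, D' (vsort x)) V :=
  forall (s : sorts Sg) (m n : nat), (s, m) \in V -> (s, n) \in V ->
    (a ((s, m) : var Sg) : D s) = a ((s, n) : var Sg) <->
    (b ((s, m) : var Sg) : D' s) = b ((s, n) : var Sg).

Lemma same_equalities_sym D D' (a : forall x : var Sg, D (vsort x))
    (b : forall x : var Sg, D' (vsort x)) V :
  same_equalities a b V -> same_equalities b a V.
Proof. by move=> ab s m n mV nV; rewrite ab. Qed.

Lemma same_equalities_trans D D' D'' (a : forall x : var Sg, D (vsort x))
    (b : forall x : var Sg, D' (vsort x))
    (c : forall x : var Sg, D'' (vsort x)) V :
  same_equalities a b V -> same_equalities b c V -> same_equalities a c V.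
Proof. by move=> ab bc s m n mV nV; rewrite ab // bc. Qed.

Lemma same_equalities_sub D D' (a : forall x : var Sg, D (vsort x))
    (b : forall x : var Sg, D' (vsort x)) X V :
  (X `<=` V)%fset -> same_equalities a b V -> same_equalities a b X.
Proof. by move=> /fsubsetP XV ab s m n /XV mV /XV nV; apply: ab. Qed.

Lemma same_equalities_eq_on D (a b : forall x : var Sg, D (vsort x)) V :
  (forall x, x \in V -> a x = b x) -> same_equalities a b V.
Proof. by move=> ab s m n mV nV; rewrite !ab. Qed.

Lemma named_finite D (a : forall x : var Sg, D (vsort x)) V s :
  finite_set (named a V s).
Proof.
apply: finite_image; apply: (@sub_finite_set _ _ [set` [fset x.2 | x in V]%fset]).
  by move=> n /= nV; apply/imfsetP; exists (s, n).
exact: finite_fset.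
Qed.

Lemma named_sub D (a : forall x : var Sg, D (vsort x)) X V s :
  (X `<=` V)%fset -> named a X s `<=` named a V s.
Proof. by move=> /fsubsetP XV _ [n /XV nV <-]; exists n. Qed.

Lemma named_eq0 D (a : forall x : var Sg, D (vsort x)) V s :
  (forall x, x \in V -> vsort x != s) -> named a V s = set0.
Proof.
by move=> Vs; rewrite -subset0 => y [n /Vs]; rewrite eqxx.
Qed.

(** Sending the value of [a] at each variable to that of [b] is well defined and injective by the
    two directions of [same_equalities]; unnamed elements go to the default [d0]. *)
Lemma same_equalities_map D D' (a : forall x : var Sg, D (vsort x))
    (b : forall x : var Sg, D' (vsort x)) V s : inhabited (D' s) ->
  same_equalities a b V ->
  exists g : D s -> D' s, (forall n, (s, n) \in V -> g (a (s, n)) = b (s, n)) /\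
    forall x y, named a V s x -> named a V s y -> g x = g y -> x = y.
Proof.
move=> [d0] ab.
have /choice[g hg] : forall d : D s, exists d' : D' s,
    forall n, (s, n) \in V -> a (s, n) = d -> b (s, n) = d'.
  move=> d; case: (pselect (named a V s d)) => [[n nV <-]|nd].
    by exists (b (s, n)) => m mV /ab; apply.
  by exists d0 => n nV e; case: nd; exists n.
exists g; split=> [n nV|_ _ [m mV <-] [n nV <-]]; first by rewrite -(hg _ n).
by rewrite -(hg _ m) // -(hg _ n) // => /ab; apply.
Qed.

Lemma same_equalities_card_le D D' (a : forall x : var Sg, D (vsort x))
    (b : forall x : var Sg, D' (vsort x)) V s : inhabited (D' s) ->
  same_equalities a b V -> named a V s #<= named b V s.
Proof.
move=> D's ab; apply/(card_le_injP _ _ D's).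
have [g [gab ginj]] := same_equalities_map D's ab.
by exists g; split=> // _ [n nV <-]; exists n; rewrite ?gab.
Qed.

(** The map from the values of [a] on [X] to those of [b] extends to an injection on all values
    named by [V], and [b'] on [V] is [a] followed by it. Domains with enough room can thus copy an
    arrangement while [b] is kept on [X]. *)
Lemma same_equalities_extend D D' (a : forall x : var Sg, D (vsort x))
    (b : forall x : var Sg, D' (vsort x)) X V :
  (forall s, inhabited (D' s)) -> (X `<=` V)%fset -> same_equalities a b X ->
  (forall s, named a V s #<= [set: D' s]) ->
  exists b' : forall x : var Sg, D' (vsort x),
    (forall x, (x \in X) || (x \notin V) -> b' x = b x) /\
    same_equalities a b' V.
Proof.
move=> D'0 XV ab aV.
have /dependent_choice_fun[f hf] : forall s, exists f : D s -> D' s,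
    (forall n, (s, n) \in X -> f (a (s, n)) = b (s, n)) /\
    forall x y, named a V s x -> named a V s y -> f x = f y -> x = y.
  move=> s; have [g [gab ginj]] := same_equalities_map (D'0 s) ab.
  have [f [fg finj]] := extend_injection (named_finite a V s)
    (named_sub XV) (aV s) ginj.
  by exists f; split=> // n nX; rewrite fg ?gab //; exists n.
exists (fun x => if x \in V then f (vsort x) (a x) else b x); split.
  move=> [s n]; case: ifP => //= xV; rewrite orbF => xX.
  by case: (hf s) => + _; apply.
move=> s m n mV nV; rewrite mV nV; split=> [->//|].
by case: (hf s) => _ finj /finj; apply; [exists m|exists n].
Qed.

Lemma holds_arrangement (M : structure Sg) (a : assignment M) V (E : rel V) :
  holds a (arrangement E) <-> forall x y : V, vsort (val x) = vsort (val y) ->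
    (E x y <-> holds a (eq_var (val x) (val y))).
Proof.
rewrite /arrangement holds_bigAnd; split=> [h x y xy|h [x y] /= /eqP xy].
  by have /= := h (x, y) (introT eqP xy); case: (E x y).
by case: ifPn => [Exy|/negP nE] /=; [apply/(h x y)|move=> /(h x y xy)].
Qed.

Lemma same_equalities_arrangement (M N : structure Sg) (a : assignment M)
    (b : assignment N) V (E : rel V) :
  holds a (arrangement E) ->
  holds b (arrangement E) <-> same_equalities a b V.
Proof.
move=> /holds_arrangement aE; rewrite holds_arrangement.
split=> [bE s m n mV nV|ab].
  have := bE [` mV]%fset [` nV]%fset erefl.
  by rewrite (aE [` mV]%fset [` nV]%fset erefl).
move=> x y xy; rewrite aE //.
case: x xy => -[s m] mV; case: y => -[s' n] nV /= e.
(* Eliminating the equality of sorts makes the recast variable in [eq_var] the second variable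
   itself. *)
by case: s' / e nV => nV; exact: ab.
Qed.

Definition arrangement_of (M : structure Sg) (a : assignment M) V : rel V :=
  fun x y => (vsort (val x) == vsort (val y)) &&
    `[< holds a (eq_var (val x) (val y)) >].
Arguments arrangement_of {M} a V.

Lemma holds_arrangement_of (M : structure Sg) (a : assignment M) V :
  holds a (arrangement (arrangement_of a V)).
Proof.
apply/holds_arrangement => x y xy; rewrite /arrangement_of xy eqxx /=.
by split=> /asboolP.
Qed.

Lemma arrangement_of_equivalence (M : structure Sg) (a : assignment M) V :
  same_sort_equivalence (arrangement_of a V).
Proof.
split=> [|x y /andP[/eqP]//]; move=> x y z.
rewrite /arrangement_of; split.
  by case: z => -[s m] mV; rewrite eqxx; apply/asboolP.
move=> /andP[/eqP]; case: x y z => -[s m] mV [[s' n] nV] [[s'' k] kV] /= e.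
case: s' / e nV => nV /asboolP/= emn; case: eqP => //= e.
case: s'' / e kV => kV.
by congr asbool; rewrite propeqE; split=> /=; rewrite emn.
Qed.


Lemma vars_arrangement V (E : rel V) : vars (arrangement E) = V.
Proof.
rewrite vars_bigAnd; apply/fsetP => x; apply/idP/idP => [|xV].
  case/bigfcupP=> -[y z] /andP[_ /= /eqP yz].
  have /= -> : vars (if E y z then eq_var (val y) (val z)
      else fNot (eq_var (val y) (val z))) = [fset val y; val z]%fset.
    by case: ifP => _ /=; rewrite yz -surjective_pairing.
  by case/fset2P=> ->; exact: valP.
(* The equation of [x] with itself, or its negation, is one of the conjuncts. *)
apply/bigfcupP; exists ([` xV]%fset, [` xV]%fset).
  by rewrite mem_index_enum /=.
by case: (E _ _); apply/fsetUP; left; apply/fset1P.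
Qed.

Lemma quantifier_free_arrangement V (E : rel V) : quantifier_free (arrangement E).
Proof. by apply: quantifier_free_bigAnd => p _ /=; case: ifP. Qed.

End Arrangements.
Arguments named {Sg D} a V s.
Arguments arrangement_of {Sg M} a V.


(** * Fresh variables and finite sizes *)

Section Prewitness.
Variables (Sg : signature) (T : theory Sg) (S : {fset sorts Sg}).
Implicit Types (phi psi : formula Sg) (A B : interpretation Sg).

Definition vars_in phi : {fset var Sg} :=
  [fset x in vars phi | vsort x \in S]%fset.

Lemma vars_inP phi x : x \in vars_in phi -> vsort x \in S.
Proof. by rewrite !inE => /andP[]. Qed.

(** The fresh variables of each sort are consecutive from [K], above all indices in [V], so that
    values can be assigned to them by the offset from [K]. *)
Lemma exists_fresh (V : {fset var Sg}) (k : sorts Sg -> nat) :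
  exists (W : {fset var Sg}) (K : nat), (forall x, x \in V -> x.2 < K) /\
    forall s n, ((s, n) \in W) = (s \in S) && (K <= n < K + k s).
Proof.
pose K := (\max_(x <- V) x.2).+1.
exists (\bigcup_(s <- S) [fset (s, n) | n in iota K (k s)])%fset, K.
split=> [x xV|s n].
  by rewrite ltnS; apply: (leq_bigmax_seq (F := snd)).
apply/bigfcupP/idP => [[s' /andP[s'S _] /imfsetP[m /= + [-> ->]]]|/andP[sS nK]].
  by rewrite s'S mem_iota.
by exists s; rewrite ?sS //; apply/imfsetP; exists n; rewrite //= mem_iota.
Qed.

Lemma finite_sizes (D : sorts Sg -> Type) :
  (forall s, s \in S -> finite_set [set: D s]) ->
  exists u : sorts Sg -> nat, forall s, s \in S -> [set: D s] #= `I_(u s).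
Proof.
move=> Dfin.
have /choice[u hu] : forall s, exists n, s \in S -> [set: D s] #= `I_n.
  move=> s; case: (boolP (s \in S)) => [sS|_]; last by exists 0.
  by have /finite_setP[n sn] := Dfin s sS; exists n.
by exists u.
Qed.

Lemma finitely_smooth_sizes : finitely_smooth T S ->
  forall (phi : QF Sg) A (k : sorts Sg -> nat), models T A ->
  satisfies A (val phi) -> (forall s, s \in S -> [set: A s] #<= `I_(k s)) ->
  exists B, [/\ models T B, satisfies B (val phi) &
    forall s, s \in S -> [set: B s] #= `I_(k s)].
Proof.
move=> sm phi A k TA Aphi Ak.
have [|B [TB Bphi Bk]] := sm phi A (k \o val) TA Aphi.
  by move=> s; apply: Ak; exact: valP.
by exists B; split=> // s sS; exact: (Bk [` sS]%fset).
Qed.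

(** * Stable finiteness and finite smoothness from a strong pre-witness *)

(** The pre-witness is applied to the arrangement of [V] in [A]. As [V] contains the variables of
    [wit phi] with sorts in [S], it alone names the [S]-domains of the new model, and equal
    arrangements name equally many elements. *)
Lemma strong_prewitness_model wit (phi : QF Sg) A V :
  strong_prewitness T S wit ->
  models T A -> satisfies A (val (wit phi)) ->
  (vars_in (val (wit phi)) `<=` V)%fset -> (forall x, x \in V -> vsort x \in S) ->
  exists B, [/\ models T B, satisfies B (val phi) &
    forall s, s \in S -> [set: B s] #= named (assign A) V s].
Proof.
move=> hwit TA Awit witV VS; have [equ named_model] := hwit phi.
set E := arrangement_of (assign A) V.
have [|B [TB [/= Bwit BE] Bnamed]] :=
    named_model V E VS (arrangement_of_equivalence _ _).
  by exists A => //; split=> //; exact: holds_arrangement_of.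
exists B; split=> // [|s sS].
  by apply/equ => //; apply/holds_exists_closure; exists (assign B).
have AB : same_equalities (assign A) (assign B) V.
  by apply/same_equalities_arrangement; [exact: holds_arrangement_of|exact: BE].
have -> : [set: B s] = named (assign B) V s.
  rewrite (Bnamed s sS); apply/seteqP; split=> _ [n /= nV <-]; exists n => //=.
    move: nV; rewrite vars_arrangement => /fsetUP[nwit|//].
    by apply: (fsubsetP witV); rewrite !inE nwit.
  by rewrite vars_arrangement; apply/fsetUP; right.
rewrite card_eq_le; apply/andP; split; apply: same_equalities_card_le => //.
- exact: dom_inhabited.
- exact: same_equalities_sym.
- exact: dom_inhabited.
Qed.

Lemma strong_prewitness_sat wit (phi : QF Sg) A :
  strong_prewitness T S wit -> models T A -> satisfies A (val phi) ->
  exists a' : assignment A, models T (Interpretation a') /\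
    holds a' (val (wit phi)).
Proof.
move=> hwit TA /(hwit phi).1 -/(_ TA) /holds_exists_closure[a' _ a'wit].
by exists a'; split=> //; apply: models_reassign TA.
Qed.

Lemma prewitness_stably_finite wit :
  strong_prewitness T S wit -> stably_finite T S.
Proof.
move=> hwit phi A TA Aphi.
have [a' [Ta' a'wit]] := strong_prewitness_sat hwit TA Aphi.
have [|B [TB Bphi BV]] := strong_prewitness_model hwit Ta' a'wit (fsubset_refl _).
  exact: vars_inP.
exists B; split=> // s sS; rewrite (eq_finite_set (BV s sS)).
split; first exact: named_finite.
by rewrite (card_le_eql (BV s sS)); exact: card_leT.
Qed.

(** The required sizes are first encoded by an assignment [e] into [nat], with the equalities of
    [a'] on [V0]. A model [C] with infinite [S]-domains has room to copy [e], and
    [strong_prewitness_model] then gives a model with as many elements as are named. *)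
Lemma prewitness_finitely_smooth wit : stably_infinite T S ->
  strong_prewitness T S wit -> finitely_smooth T S.
Proof.
move=> si hwit phi A kappa TA Aphi Ak.
have [a' [Ta' a'wit]] := strong_prewitness_sat hwit TA Aphi.
pose k s := if insub s is Some t then kappa t else 0.
have kE (t : S) : k (val t) = kappa t by rewrite /k valK.
set V0 := vars_in (val (wit phi)).
pose E := arrangement_of a' V0.
(* Adding the arrangement of [V0] to the formula makes [C] inherit the equalities of [a']. *)
have qf : quantifier_free (fAnd (val (wit phi)) (arrangement E)).
  by rewrite /= (valP (wit phi)) quantifier_free_arrangement.
have [|C [TC [/= Cwit CE] Cinf]] :=
    si (exist (fun chi => quantifier_free chi) _ qf).
  exists (Interpretation a') => //.
  by split=> //; exact: holds_arrangement_of.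
have {CE} a'C : same_equalities a' (assign C) V0.
  by apply/same_equalities_arrangement; [exact: holds_arrangement_of|exact: CE].
have [W [K [V0K WK]]] := exists_fresh V0 k.
set V := (V0 `|` W)%fset.
have VS x : x \in V -> vsort x \in S.
  by case: x => s n /fsetUP[/vars_inP//|]; rewrite WK => /andP[].
have /dependent_choice_fun[f hf] : forall s, exists f : A s -> nat,
    s \in S -> (forall x, f x < k s) /\ injective f.
  move=> s; case: (pselect (s \in S)) => [sS|]; last by exists (fun=> 0).
  have := Ak [` sS]%fset; rewrite -kE.
  case/(card_le_injP _ _ (inhabits 0)) => f [fk finj].
  by exists f => _; split=> [x|x y]; [exact: fk|exact: finj].
(* The values f gives to V0 are completed by the fresh variables so that
   exactly the numbers below k s are named. *)
pose e (x : var Sg) : nat := if x.2 < K then f (vsort x) (a' x) else x.2 - K.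
have eV s : s \in S -> named (D := fun=> nat) e V s = `I_(k s).
  move=> sS; apply/seteqP; split=> [_ [n /= nV <-]|i /= ik].
    rewrite /e /=; case: (ltnP n K) => [nK|Kn]; first by case: (hf s sS).
    case/fsetUP: nV => [/V0K|]; first by rewrite ltnNge Kn.
    by rewrite WK => /and3P[_ _]; rewrite ltn_subLR.
  exists (K + i)%N => /=.
    by apply/fsetUP; right; rewrite WK sS leq_addr ltn_add2l.
  by rewrite /e /= ltnNge leq_addr addKn.
have a'e : same_equalities (D' := fun=> nat) a' e V0.
  move=> s m n mV nV; rewrite /e /= (V0K _ mV) (V0K _ nV).
  by split=> [->//|]; case: (hf s (vars_inP mV)) => _; exact.
have eC := same_equalities_trans (same_equalities_sym a'e) a'C.
have [|||c [cC ec]] := same_equalities_extend _ _ eC (V := V).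
- exact: dom_inhabited.
- exact: fsubsetUl.
- move=> s; case: (boolP (s \in S)) => [sS|nS].
    apply: card_le_trans (card_leT _) _.
    by apply/infiniteP; exact: Cinf.
  by rewrite named_eq0 // => x /VS xS; apply: contraNneq nS => <-.
have Tc : models T (Interpretation c) by apply: models_reassign TC.
(* Only variables of [W] change in passing to [c], and none of them occurs in [wit phi]. *)
have cwit : satisfies (Interpretation c) (val (wit phi)).
  apply/(holds_eq_on (b := assign C)) => // x xwit; apply: cC.
  case: (boolP (vsort x \in S)) => xS; first by rewrite !inE xwit xS.
  by apply/orP; right; apply: contra xS; exact: VS.
have [B [TB Bphi BV]] := strong_prewitness_model hwit Tc cwit (fsubsetUl _ _) VS.
exists B; split=> // s; rewrite -kE -(eV _ (valP s)).
apply: card_eq_trans (BV _ (valP s)) _ => /=.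
rewrite card_eq_le; apply/andP; split; apply: same_equalities_card_le => //.
- exact: same_equalities_sym.
- exact: dom_inhabited.
Qed.

(** * Stable infiniteness and a strong pre-witness from finite models *)

Lemma smooth_stably_infinite :
  stably_finite T S -> finitely_smooth T S -> stably_infinite T S.
Proof.
move=> sf sm phi [A TA Aphi]; apply: stably_infinite_of_unbounded => n.
have [B [TB Bphi Bfin]] := sf phi A TA Aphi.
have [u Bu] := finite_sizes (fun s sS => (Bfin s sS).1).
(* Finite smoothness prescribes only sizes at least the present ones, hence [u s + n] rather than
   [n]. *)
have [|C [TC Cphi Cu]] :=
    finitely_smooth_sizes sm (k := fun s => (u s + n)%N) TB Bphi.
  by move=> s sS; rewrite (card_le_eql (Bu s sS)) card_le_II leq_addr.
exists C; split=> // s sS.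
by rewrite (card_le_eqr (Cu s sS)) card_le_II leq_addl.
Qed.

(** There are finitely many Boolean matrices on [X], and [psi] excludes those realized in no [B]
    satisfying [Q]. A conjunction over all matrices, instead of a disjunction of the realized ones,
    keeps the variables equal to [X] even when none is realized. *)
Lemma definable_equalities (X : {fset var Sg}) (Q : interpretation Sg -> Prop) :
  exists psi, [/\ quantifier_free psi, vars psi = X &
    forall A, satisfies A psi <->
      exists2 B, Q B & same_equalities (assign A) (assign B) X].
Proof.
pose arr (F : {ffun X * X -> bool}) := arrangement (fun x y => F (x, y)).
pose allowed F := `[< exists2 B, Q B & satisfies B (arr F) >].
exists (\big[@fAnd Sg/fTop]_(F : {ffun X * X -> bool})
  fImp (arr F) (if allowed F then fTop else fNot fTop)); split.
- apply: quantifier_free_bigAnd => F _ /=.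
  by rewrite quantifier_free_arrangement; case: ifP.
- have varsF F (b : bool) :
      vars (fImp (arr F) (if b then fTop else fNot fTop)) = X.
    rewrite -[RHS](vars_arrangement (fun x y => F (x, y))).
    by case: b; exact: fsetU0.
  rewrite vars_bigAnd; apply/fsetP => x; apply/bigfcupP/idP => [[F _]|xX].
    by rewrite varsF.
  by exists [ffun=> true]; rewrite ?varsF ?mem_index_enum.
move=> A; rewrite /satisfies holds_bigAnd.
pose FA : {ffun X * X -> bool} :=
  [ffun p => arrangement_of (assign A) _ p.1 p.2].
have AFA : holds (assign A) (arrangement (fun x y => FA (x, y))).
  apply/holds_arrangement => x y xy; rewrite ffunE.
  exact: (holds_arrangement _ _).1 (holds_arrangement_of _ _) x y xy.
split=> [/(_ FA isT AFA)|[B QB AB] F _ /= AF].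
  case: ifP => [/asboolP[B QB BFA] _|_ []//].
  exists B => //.
  exact: (iffLR (same_equalities_arrangement (assign B) AFA) BFA).
rewrite ifT //; apply/asboolP; exists B => //.
exact/(same_equalities_arrangement _ AF).
Qed.

(* Dickson's lemma, applied to each of the finitely many arrangements of the
   variables of phi, bounds the sizes of the minimal models uniformly. *)
Lemma small_models (phi : QF Sg) : stably_finite T S ->
  exists N, forall A, models T A -> satisfies A (val phi) ->
  exists B, [/\ models T B, satisfies B (val phi),
    same_equalities (assign A) (assign B) (vars_in (val phi)) &
    forall s, s \in S -> [set: B s] #<= [set: A s] /\ [set: B s] #<= `I_N].
Proof.
move=> sf; set U := vars_in (val phi).
pose arr (F : {ffun U * U -> bool}) := arrangement (fun x y => F (x, y)).
pose sizes F := [set u : sorts Sg -> nat | exists B, [/\ models T B,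
  satisfies B (val phi), satisfies B (arr F) &
  forall s, s \in S -> [set: B s] #= `I_(u s)]].
have /choice[N hN] := fun F => dickson_bounded (enum_fset S) (sizes F).
exists (\max_F N F) => A TA Aphi.
pose F : {ffun U * U -> bool} := [ffun p => arrangement_of (assign A) _ p.1 p.2].
have AF : holds (assign A) (arrangement (fun x y => F (x, y))).
  apply/holds_arrangement => x y xy; rewrite ffunE.
  exact: (holds_arrangement _ _).1 (holds_arrangement_of _ _) x y xy.
have qf : quantifier_free (fAnd (val phi) (arr F)).
  by rewrite /= (valP phi) quantifier_free_arrangement.
(* Dickson's lemma compares finite sizes only, so [A] is first replaced by a [B] with finite
   [S]-domains and the same arrangement. *)
have [//|B [TB [/= Bphi BF] Bfin]] :=
    sf (exist (fun chi => quantifier_free chi) _ qf) A TA.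
have [u Bu] := finite_sizes (fun s sS => (Bfin s sS).1).
have [|v [C [TC Cphi CF Cv]] vu] := hN F u; first by exists B.
exists C; split=> //.
  exact: (iffLR (same_equalities_arrangement (assign C) AF) CF).
move=> s sS; have [vus vN] := vu s sS; split.
  apply: card_le_trans (Bfin s sS).2.
  by rewrite (card_le_eql (Cv s sS)) (card_le_eqr (Bu s sS)) card_le_II.
rewrite (card_le_eql (Cv s sS)) card_le_II; apply: leq_trans vN _.
exact: leq_bigmax.
Qed.

(** The values of [W] in [B] are chosen to exhaust its [S]-domains, which have at most [N] elements.
    Since these are no larger than those of [A], the equalities can be copied back to an assignment
    [a] in [A]. *)
Lemma small_models_named (phi : QF Sg) : stably_finite T S ->
  exists W : {fset var Sg}, [/\ forall x, x \in W -> vsort x \in S,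
    forall x, x \in W -> x \notin vars (val phi) &
    forall A, models T A -> satisfies A (val phi) ->
    exists (a : assignment A) B,
      [/\ forall x, x \notin W -> a x = assign A x,
          models T B, satisfies B (val phi),
          same_equalities a (assign B) (vars_in (val phi) `|` W)%fset &
          forall s, s \in S ->
            [set: B s] = named (assign B) (vars_in (val phi) `|` W)%fset s]].
Proof.
move=> sf; have [N hN] := small_models phi sf.
have [W [K [phiK WK]]] := exists_fresh (vars (val phi)) (fun=> N).
have WS x : x \in W -> vsort x \in S by case: x => s n; rewrite WK => /andP[].
have Wphi x : x \in W -> x \notin vars (val phi).
  move=> xW; apply/negP => /phiK; case: x xW => s n.
  rewrite WK /= => /and3P[_ Kn _].
  by rewrite ltnNge Kn.
exists W; split=> // A TA Aphi.
have [B [TB Bphi AB BN]] := hN A TA Aphi.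
set U := vars_in (val phi) in AB *; set X := (U `|` W)%fset.
(* [g] inverts an injection [f] of [B s] into the numbers below [N]; numbers outside its image get
   the default [d0]. *)
have /dependent_choice_fun[g hg] : forall s, exists g : nat -> B s,
    s \in S -> forall d, exists2 i, i < N & g i = d.
  move=> s; have [d0] := dom_inhabited B s.
  case: (pselect (s \in S)) => [sS|]; last by exists (fun=> d0).
  have [_ /(card_le_injP _ _ (inhabits 0))[f [fN finj]]] := BN s sS.
  have /choice[g hg] : forall i, exists d, forall d', f d' = i -> d = d'.
    move=> i; case: (pselect (exists d, f d = i)) => [[d <-]|nd].
      by exists d => d' /esym; exact: finj.
    by exists d0 => d' d'i; case: nd; exists d'.
  by exists g => _ d; exists (f d); [exact: fN|exact: hg].
pose b : assignment B :=
  fun x => if x \in W then g (vsort x) (x.2 - K) else assign B x.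
have bphi x : x \in vars (val phi) -> b x = assign B x.
  by rewrite /b; case: ifP => // /Wphi/negP.
have Bnamed s : s \in S -> [set: B s] = named b X s.
  move=> sS; apply/seteqP; split=> // d _; have [i iN <-] := hg s sS d.
  have iW : (s, (K + i)%N) \in W by rewrite WK sS leq_addr ltn_add2l.
  by exists (K + i)%N; [apply/fsetUP; right|rewrite /b iW /= addKn].
have bA : same_equalities b (assign A) U.
  apply/same_equalities_sym/(same_equalities_trans AB)/same_equalities_eq_on.
  by move=> x; rewrite !inE => /andP[/bphi->].
have XS x : x \in X -> vsort x \in S by case/fsetUP=> [/vars_inP|/WS].
have [|||a [aA ba]] := same_equalities_extend _ _ bA (V := X).
- exact: dom_inhabited.
- exact: fsubsetUl.
- move=> s; case: (boolP (s \in S)) => [sS|nS].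
    by rewrite -Bnamed //; case: (BN s sS).
  by rewrite named_eq0 // => x /XS xS; apply: contraNneq nS => <-.
exists a, (Interpretation b); split=> //.
- move=> x xW; apply: aA; rewrite /X in_fsetU (negbTE xW) orbF; exact: orbN.
- exact: models_reassign TB.
- by apply/(holds_eq_on (b := assign B)).
- exact: same_equalities_sym.
Qed.

Lemma smooth_prewitness :
  stably_finite T S -> finitely_smooth T S -> has_strong_prewitness T S.
Proof.
(* The pre-witness condition for a single pair of formulas, so that [wit] arises by choosing a [psi]
   for each [phi]. *)
move=> sf sm; pose is_wit (phi psi : formula Sg) :=
  equivalent T phi (exists_closure (vars psi `\` vars phi)%fset psi) /\
  forall (V : {fset var Sg}) (E : rel V),
    (forall x, x \in V -> vsort x \in S) -> same_sort_equivalence E ->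
    let chi := fAnd psi (arrangement E) in
    satisfiable T chi ->
    exists A, [/\ models T A, satisfies A chi &
      forall s, s \in S -> named_by_vars A chi s].
suff ex_wit (phi : QF Sg) :
    exists2 psi, quantifier_free psi & is_wit (val phi) psi.
  have /choice[wit hwit] : forall phi : QF Sg, exists psi : QF Sg,
      is_wit (val phi) (val psi).
    move=> phi; have [psi qf psi_wit] := ex_wit phi.
    by exists (exist (fun chi => quantifier_free chi) psi qf).
  by exists wit.
have [W [WS Wphi hW]] := small_models_named phi sf.
set U := vars_in (val phi) in hW; set X := (U `|` W)%fset in hW.
have XS x : x \in X -> vsort x \in S by case/fsetUP=> [/vars_inP|/WS].
have [psi [psi_qf psi_vars psiP]] := definable_equalities X
  (fun B => [/\ models T B, satisfies B (val phi) &
     forall s, s \in S -> [set: B s] = named (assign B) X s]).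
pose chi := fAnd (val phi) psi.
have qf : quantifier_free chi by rewrite /= (valP phi).
exists chi => //.
have chi_vars : vars chi = (vars (val phi) `|` X)%fset by rewrite -psi_vars.
rewrite /is_wit chi_vars; split.
  move=> A TA; rewrite /satisfies holds_exists_closure.
  split=> [|[a aA [aphi _]]].
    move=> Aphi; have [a [B [aA TB Bphi aB Bnamed]]] := hW A TA Aphi.
    have aphi : holds a (val phi).
      apply/(holds_eq_on (b := assign A)) => // x xphi; apply: aA.
      by apply: contraL xphi; exact: Wphi.
    exists a; last by split=> //; apply/(psiP (Interpretation a)); exists B.
    move=> x xn; rewrite aA //; apply: contra xn => xW.
    by rewrite in_fsetD in_fsetU (Wphi _ xW) /X in_fsetU xW !orbT.
  apply/(holds_eq_on (b := a)) => // x xphi; apply: aA.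
  by rewrite in_fsetD xphi.
move=> V E VS Eequiv [A TA [[Aphi /(psiP A)[B [TB Bphi Bnamed] AB]] AE]].
set Y := (X `|` V)%fset.
have YS x : x \in Y -> vsort x \in S by case/fsetUP=> [/XS|/VS].
(* [k s] counts the elements that [Y] names in [A]. Since [X] lies in [Y] and names all of [B] on
   [S], finite smoothness can raise the sizes of [B] to [k]. *)
have /choice[k Ak] := fun s => (finite_setP _).1 (named_finite (assign A) Y s).
(* Enlarging [B] must preserve the arrangement of [X], since this is what makes [psi] hold. *)
have qfB : quantifier_free
    (fAnd (val phi) (arrangement (arrangement_of (assign B) X))).
  by rewrite /= (valP phi) quantifier_free_arrangement.
have Ble s : s \in S -> [set: B s] #<= `I_(k s).
  move=> sS; rewrite (Bnamed s sS) -(card_le_eqr (Ak s)).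
  apply: card_le_trans (subset_card_le (named_sub (fsubsetUl X V))).
  apply: same_equalities_card_le; first exact: dom_inhabited.
  exact: same_equalities_sym.
have [|C [TC [/= Cphi CB] Ck]] := finitely_smooth_sizes sm
    (phi := exist (fun chi => quantifier_free chi) _ qfB) TB _ Ble.
  by split=> //; exact: holds_arrangement_of.
have {CB}BC : same_equalities (assign B) (assign C) X.
  by apply/same_equalities_arrangement; [exact: holds_arrangement_of|exact: CB].
(* For [s] in [S], [C s] has exactly as many elements as [Y] names in [A], so the equalities on all
   of [Y] can be copied there while the values on [X] are kept. *)
have [|||c [cC Ac]] :=
    same_equalities_extend _ _ (same_equalities_trans AB BC) (V := Y).
- exact: dom_inhabited.
- exact: fsubsetUl.
- move=> s; case: (boolP (s \in S)) => [sS|nS].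
    by rewrite (card_le_eql (Ak s)) (card_le_eqr (Ck s sS)).
  by rewrite named_eq0 // => x /YS xS; apply: contraNneq nS => <-.
exists (Interpretation c); split.
- exact: models_reassign TC.
- split; last first.
    apply/(same_equalities_arrangement _ AE).
    exact: same_equalities_sub (fsubsetUr X V) Ac.
  split.
    apply/(holds_eq_on (b := assign C)) => // x xphi; apply: cC.
    case: (boolP (vsort x \in S)) => xS; first by rewrite !inE xphi xS.
    by apply/orP; right; apply: contra xS; exact: YS.
  apply/(psiP (Interpretation c)); exists B => //.
  apply: same_equalities_trans (same_equalities_sym BC).
  by apply: same_equalities_eq_on => x xX; apply: cC; rewrite xX.
(* Under [c], [Y] names [k s] elements, as many as the finite domain contains, hence all of them. *)
move=> s sS; have cY : named c Y s = [set: C s].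
  apply: finite_card_le_sub_eq => //.
    by apply/finite_setP; exists (k s); exact: Ck.
  rewrite (card_le_eql (Ck s sS)) -(card_le_eql (Ak s)).
  by apply: same_equalities_card_le => //; exact: dom_inhabited.
apply/seteqP; split=> // d _; have : [set: C s] d by [].
rewrite -cY => -[n /= nY <-]; exists n => //.
have : (s, n) \in vars chi \/ (s, n) \in vars (arrangement E).
  rewrite chi_vars vars_arrangement in_fsetU.
  by case/fsetUP: nY => ->; rewrite ?orbT; [left|right].
by move=> /fsetUP.
Qed.

End Prewitness.

Theorem theorem9 (Sg : signature) (T : theory Sg) (S : {fset sorts Sg}) :
  (stably_finite T S /\ finitely_smooth T S) <->
  (stably_infinite T S /\ has_strong_prewitness T S).
Proof.
split=> [[sf sm]|[si [wit hwit]]]; split.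
- exact: smooth_stably_infinite.
- exact: smooth_prewitness.
- exact: prewitness_stably_finite hwit.
- exact: prewitness_finitely_smooth hwit.
Qed.
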